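(* Let $k$ be a field, $n\geq 1$, $[d]\in\mathbb{N}_{\geq 1}^n$, let $P(\underline{X},Z)\in k[\underline{X},Z]$ be a monic polynomial in $Z$ with $r:=\deg_Z P(\underline{X},Z)\geq 2$, and let $Q(\underline{X},Y,Z)\in k[\underline{X},Y,Z]$ be a monic polynomial in $Y$ with $s:=\deg_Y Q(\underline{X},Y,Z)\geq 2$. For $[e]\in\mathbb{N}_{\geq 1}^n$ put $$L_{[d],[e]}=\frac{k[\underline{X},Y,Z,T]}{(\underline{X}^{[d]}Y-P(\underline{X},Z),\ \underline{X}^{[e]}T-Q(\underline{X},Y,Z))}.$$ Write $P'(\underline{X},Z):=\frac{\partial P(\underline{X},Z)}{\partial Z}$ and $Q'(\underline{X},Y,Z):=\frac{\partial Q(\underline{X},Y,Z)}{\partial Y}$. Suppose that for all $i\in\{1,\ldots,n\}$, $$\big(P(\underline{X},Z)|_{X_i=0},\ P'(\underline{X},Z)|_{X_i=0}\big)k[\underline{X}_{\hat{X_i}},Z]=k[\underline{X}_{\hat{X_i}},Z]$$ and $$\big(P(\underline{X},Z)|_{X_i=0},\ Q(\underline{X},Y,Z)|_{X_i=0},\ Q'(\underline{X},Y,Z)|_{X_i=0}\big)k[\underline{X}_{\hat{X_i}},Y,Z]=k[\underline{X}_{\hat{X_i}},Y,Z].$$ Then, for any $[e]\in\mathbb{N}_{\geq 2}^n$, $$L_{[d],[e]}^{[1]}\cong L_{[d],[e]-1}^{[1]}$$ as $k$-algebras.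
   Context: Notation: $\underline{X}=(X_1,\ldots,X_n)$, and $X_1,\ldots,X_n,Y,Z,T$ are indeterminates over $k$. For $[d]=(d_1,\ldots,d_n)$, $\underline{X}^{[d]}:=X_1^{d_1}\cdots X_n^{d_n}$, and similarly for $[e]=(e_1,\ldots,e_n)$. $[e]-1:=(e_1-1,\ldots,e_n-1)$. $\mathbb{N}_{\geq m}$ is the set of integers $\geq m$. $\underline{X}_{\hat{X_i}}$ denotes the list of variables $X_1,\ldots,X_n$ with $X_i$ removed. For a polynomial $F$, $F|_{X_i=0}$ is obtained by setting $X_i=0$. For a ring $R$, $R^{[1]}$ denotes the polynomial ring in one variable over $R$. *)

(* Defs.v *)
From HB Require Import structures.
From mathcomp Require Import all_boot all_order all_algebra.
From mathcomp Require Import generic_quotient ring_quotient fraction.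
From mathcomp Require Import boolp.
From mathcomp Require Import mpoly.

Set Implicit Arguments.
Unset Strict Implicit.
Unset Printing Implicit Defensive.

Import GRing.Theory.
Local Open Scope ring_scope.
Local Open Scope quotient_scope.

Section IdealGen.
Variable R : comNzRingType.

Definition ideal_gen (s : seq R) : {pred R} :=
  fun x => `[< exists c : 'I_(size s) -> R, x = \sum_(i < size s) c i * s`_i >].

Lemma ideal_genP (s : seq R) (x : R) :
  reflect (exists c : 'I_(size s) -> R, x = \sum_(i < size s) c i * s`_i)
          (x \in ideal_gen s).
Proof. exact: asboolP. Qed.

Lemma ideal_gen_closed (s : seq R) :
  1 \notin ideal_gen s -> idealr_closed (ideal_gen s).
Proof.
move=> s1; split=> //.
  apply/ideal_genP; exists (fun=> 0).
  by rewrite big1 // => i _; rewrite mul0r.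
move=> a x y /ideal_genP[c ->] /ideal_genP[c' ->].
apply/ideal_genP; exists (fun i => a * c i + c' i).
rewrite mulr_sumr -big_split; apply: eq_bigr => i _ /=.
by rewrite mulrDl mulrA.
Qed.

(* A ring morphism to a nontrivial ring killing the generators shows that
   the ideal is proper. *)
Lemma ideal_gen_proper (S : nzRingType) (f : {rmorphism R -> S}) (s : seq R) :
  (forall i : 'I_(size s), f s`_i = 0) -> 1 \notin ideal_gen s.
Proof.
move=> fs; apply/negP => /ideal_genP[c /(congr1 f)].
rewrite rmorph1 rmorph_sum big1 => [/eqP|i _]; first by rewrite oner_eq0.
by rewrite rmorphM fs mulr0.
Qed.

Definition is_unit_ideal (s : seq R) : Prop := forall x : R, x \in ideal_gen s.

End IdealGen.

(* A k-algebra is a commutative ring with a structure morphism from k. *)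
Definition algebras_isomorphic (k A B : comNzRingType)
    (iA : {rmorphism k -> A}) (iB : {rmorphism k -> B}) : Prop :=
  exists f : {rmorphism A -> B}, bijective f /\ forall c : k, f (iA c) = iB c.

(* A[Y][T] / (a Y - p, b T - q); in {poly {poly A}} the outer variable is T.
   The proofs that a and b are nonzero are parameters because they make the
   ideal proper, which the library requires of the quotient ring. *)
Section DoubleQuotient.
Variables (A : idomainType) (a b : A) (a0 : a != 0) (b0 : b != 0).
Variables (p : A) (q : {poly A}).
Variables (k : comNzRingType) (iA : {rmorphism k -> A}).

Definition dquot_gens : seq {poly {poly A}} :=
  [:: (a%:P * 'X - p%:P)%:P; b%:P%:P * 'X - q%:P].

(* Y |-> p / a and T |-> q(p / a) / b define a morphism to the fraction field
   of A. *)
Lemma dquot_gens_proper : 1 \notin ideal_gen dquot_gens.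
Proof.
pose K := {fraction A}.
have a0' : tofrac a != 0 :> K by rewrite tofrac_eq0.
have b0' : tofrac b != 0 :> K by rewrite tofrac_eq0.
pose g : {rmorphism {poly A} -> K} :=
  horner_morph (fun c => mulrC (tofrac p / tofrac a) (tofrac c)).
have gC c : g c%:P = tofrac c by exact: horner_morphC.
have gX : g 'X = tofrac p / tofrac a by exact: horner_morphX.
clearbody g.
pose f : {rmorphism {poly {poly A}} -> K} :=
  horner_morph (fun c => mulrC (g q / tofrac b) (g c)).
have fC c : f c%:P = g c by exact: horner_morphC.
have fX : f 'X = g q / tofrac b by exact: horner_morphX.
clearbody f.
apply: (@ideal_gen_proper _ _ f); case; case=> [|[|i]] //= _.
  by rewrite fC rmorphB rmorphM !gC gX mulrC divfK // subrr.
by rewrite rmorphB rmorphM !fC gC fX mulrC divfK // subrr.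
Qed.

Definition dquot_ideal of a != 0 & b != 0 : {pred {poly {poly A}}} :=
  ideal_gen dquot_gens.

HB.instance Definition _ :=
  isIdealr.Build {poly {poly A}} (dquot_ideal a0 b0)
    (ideal_gen_closed dquot_gens_proper).

Definition dquot_ring : comNzRingType := {ideal_quot (dquot_ideal a0 b0)}.

Definition dquot_pi : {rmorphism {poly {poly A}} -> dquot_ring} :=
  \pi_{ideal_quot (dquot_ideal a0 b0)}.

(* Structure morphisms over k of the quotient L and of L^[1] = L[W], when A is
   a k-algebra. *)
Definition dquot_const : {rmorphism k -> dquot_ring} :=
  dquot_pi \o polyC \o polyC \o iA.

Definition dquot_poly_const : {rmorphism k -> {poly dquot_ring}} :=
  polyC \o dquot_const.

End DoubleQuotient.

Section SetX0.
Variables (k : fieldType) (n : nat).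

(* The morphism k[X_1, ..., X_n] -> k[X_1, ..., X_n without X_i] sending X_i
   to 0 and every other variable to itself; [unlift i] renumbers the indices
   different from i by 'I_n.-1. *)
Definition setX0 (i : 'I_n) (p : {mpoly k[n]}) : {mpoly k[n.-1]} :=
  p \mPo [tuple if unlift i j is Some j' then 'X_j' else 0 | j < n].

End SetX0.

Section DoubleDanielewski.
Variables (k : fieldType) (n : nat).

Lemma monomial_neq0 (m : 'X_{1..n}) :
  ('X_[m] : {mpoly k[n]})%:P != 0 :> {poly {mpoly k[n]}}.
Proof.
rewrite polyC_eq0; apply/negP => /eqP/(congr1 (mcoeff m)).
by rewrite mcoeffX eqxx mcoeff0 => /eqP; rewrite oner_eq0.
Qed.

(* k[X, Z] is {poly {mpoly k[n]}}, with variable Z, and k[X, Y, Z] is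
   {poly {poly {mpoly k[n]}}}, with outer variable Y. *)
Variables (d e : 'X_{1..n}).
Variables (P : {poly {mpoly k[n]}}) (Q : {poly {poly {mpoly k[n]}}}).

(* The double Danielewski algebra
   L_{[d],[e]} = k[X, Y, Z, T] / (X^[d] Y - P, X^[e] T - Q). *)
Definition dd_ring : comNzRingType :=
  dquot_ring (monomial_neq0 d) (monomial_neq0 e) P Q.

Definition kXZ_const : {rmorphism k -> {poly {mpoly k[n]}}} :=
  polyC \o @mpolyC n k.

Definition dd_poly_const : {rmorphism k -> {poly dd_ring}} :=
  dquot_poly_const (monomial_neq0 d) (monomial_neq0 e) P Q kXZ_const.

End DoubleDanielewski.

(* Main.v *)
Require Import Defs.
From HB Require Import structures.
From mathcomp Require Import all_boot all_order all_algebra.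
From mathcomp Require Import generic_quotient ring_quotient.
From mathcomp Require Import boolp ring.
From mathcomp Require Import mpoly.

Set Implicit Arguments.
Unset Strict Implicit.
Unset Printing Implicit Defensive.

Import GRing.Theory.
Local Open Scope ring_scope.

(** Write R for k[X_1, ..., X_n], x for the product of the variables, a for the
    monomial X^[d] and b1 for X^([e]-1), so that b = x b1 is X^[e]. Where
    x is invertible, both algebras are R[1/x][Z]. Over x = 0 both are, because x
    divides a and b1, the product of a line (with coordinate T) and the scheme
    P = Q = 0, and the hypotheses say that P' Q' is invertible there: this scheme
    is etale over x = 0. Hence both are additive torsors over the same
    nonseparated base, Spec R with x = 0 replaced by P = Q = 0, and the
    isomorphism is Danielewski's: the fibre product of two torsors over a common
    base is a trivial torsor over each factor, as the factors are affine.

    Everything can be made explicit. The fibre product is described by points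
    (z, y, t, v) of L[V] and (z', y', t', w) of L'[W], with L = L_{[d],[e]} and
    L' = L_{[d],[e]-1}, linked by

      z' = z + a b1 v     and     v = g(z', y') t' + x w,

    where g is a polynomial inverse of P' Q' modulo (P, Q, x). Taylor expansion
    gives y' = y + b1 v (P'(z) + ...) and t' = x t + v (P'(z) Q'(z, y) + x ...).
    Hence v - g t' is divisible by x whenever (z, y, t, v) is given, and
    t' - v (P' Q' + x ...) is divisible by x whenever (z', y', t', w) is given
    ([dd_corr_down], [dd_corr_up]). No derivation is exponentiated, so the
    characteristic does not matter.

    Read on generic points, the correspondence gives morphisms in both
    directions. They are inverse to each other ([stable_iso]) because the
    divided quantities are unique: the monomials are regular in L and L'. This
    regularity ([dquot_lreg]) holds because P is monic in Z and Q monic in Y,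
    so that each X_i, P, Q is a regular sequence. Finally g exists because the
    assumed comaximality, which concerns each hyperplane X_i = 0 separately,
    lifts to k[X, Y, Z] and multiplies up to the divisor x = 0
    ([unit_mod_derivP], [unit_mod_derivQ], [unit_mod_prod]). *)

(** * Evaluation of polynomials and Taylor expansion *)

Section EvalAt.
Variables (R S : comNzRingType) (j : {rmorphism R -> S}).

Definition eval_at (z : S) : {rmorphism {poly R} -> S} :=
  horner_morph (fun c => mulrC z (j c)).

Lemma eval_atC z c : eval_at z c%:P = j c.
Proof. exact: horner_morphC. Qed.

Lemma eval_atX z : eval_at z 'X = z.
Proof. exact: horner_morphX. Qed.

(** The remainder is only asserted to exist: this avoids divided powers and is
    all that divisibility arguments need. *)
Lemma taylor2 z h p : exists r,
  eval_at (z + h) p = eval_at z p + h * eval_at z p^`() + h ^+ 2 * r.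
Proof.
elim/poly_ind: p => [|p c [r IH]]; first by exists 0; rewrite deriv0 !rmorph0; ring.
exists (eval_at z p^`() + r * (z + h)).
rewrite derivMXaddC !rmorphD !rmorphM !eval_atX !eval_atC IH /=.
by ring.
Qed.

End EvalAt.
Arguments eval_at {R S} j z.

Lemma rmorph_poly_ext (R S : comNzRingType) (f g : {rmorphism {poly R} -> S}) :
  (forall c, f c%:P = g c%:P) -> f 'X = g 'X -> f =1 g.
Proof.
move=> fgC fgX p; elim/poly_ind: p => [|p c IH]; first by rewrite !rmorph0.
by rewrite !rmorphD !rmorphM IH fgX fgC.
Qed.

Lemma rmorph_poly3_ext (R S : comNzRingType)
    (f g : {rmorphism {poly {poly {poly R}}} -> S}) :
  (forall c, f c%:P%:P%:P = g c%:P%:P%:P) -> f 'X%:P%:P = g 'X%:P%:P ->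
  f 'X%:P = g 'X%:P -> f 'X = g 'X -> f =1 g.
Proof.
move=> fgC fgZ fgY; apply: rmorph_poly_ext => q.
apply: (@rmorph_poly_ext _ _ (f \o polyC) (g \o polyC)) => // p.
exact: (@rmorph_poly_ext _ _ (f \o polyC \o polyC) (g \o polyC \o polyC)).
Qed.

Lemma rmorph_quot_ext (R L S : comNzRingType)
    (pi : {rmorphism {poly {poly {poly R}}} -> L}) (f g : {rmorphism {poly L} -> S}) :
  (forall l, exists h, l = pi h) ->
  (forall c, f (pi c%:P%:P%:P)%:P = g (pi c%:P%:P%:P)%:P) ->
  f (pi 'X%:P%:P)%:P = g (pi 'X%:P%:P)%:P -> f (pi 'X%:P)%:P = g (pi 'X%:P)%:P ->
  f (pi 'X)%:P = g (pi 'X)%:P -> f 'X = g 'X -> f =1 g.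
Proof.
move=> pi_surj fgC fgZ fgY fgT; apply: rmorph_poly_ext => l.
have [h ->] := pi_surj l.
exact: (@rmorph_poly3_ext _ _ (f \o polyC \o pi) (g \o polyC \o pi)).
Qed.

Lemma rmorph_eval (R S S' : comNzRingType) (j : {rmorphism R -> S})
    (j' : {rmorphism R -> S'}) (f : {rmorphism S -> S'}) :
  (forall c, f (j c) = j' c) ->
  forall z p, f (eval_at j z p) = eval_at j' (f z) p.
Proof.
move=> fj z.
apply: (@rmorph_poly_ext _ _ (f \o eval_at j z) (eval_at j' (f z))) => [c|] /=.
  by rewrite !eval_atC fj.
by rewrite !eval_atX.
Qed.

(** When j and j' are evaluations at two points differing by h, this moves the
    inner variable of an iterated polynomial. *)
Lemma eval_at_shift (R S : comNzRingType) (j j' : {rmorphism R -> S}) (h : S) :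
  (forall c, exists r, j' c = j c + h * r) ->
  forall z p, exists r, eval_at j' z p = eval_at j z p + h * r.
Proof.
move=> jj' z p; elim/poly_ind: p => [|p c [r IH]].
  by exists 0; rewrite !rmorph0; ring.
have [s js] := jj' c; exists (r * z + s).
rewrite !rmorphD !rmorphM !eval_atX !eval_atC IH js /=.
by ring.
Qed.

Lemma taylor_inner (R S : comNzRingType) (j : {rmorphism R -> S}) (z h y : S) q :
  exists r, eval_at (eval_at j (z + h)) y q = eval_at (eval_at j z) y q + h * r.
Proof.
apply: eval_at_shift => p; have [r ->] := taylor2 j z h p.
by exists (eval_at j z p^`() + h * r); ring.
Qed.

Lemma taylor_xy (R S : comNzRingType) (j : {rmorphism R -> S}) (z h y l : S) q :
  exists r s, eval_at (eval_at j (z + h)) (y + l) q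
    = eval_at (eval_at j z) y q + l * eval_at (eval_at j z) y q^`()
      + h * r + l ^+ 2 * s.
Proof.
have [r ->] := taylor_inner j z h (y + l) q.
have [s ->] := taylor2 (eval_at j z) y l q.
by exists r, s; ring.
Qed.

(** * The correspondence between points of the two algebras *)

(** f is invertible modulo (p, q, x); the inverse stays a polynomial rather than
    a class in a quotient, so that it can be evaluated anywhere. *)
Definition unit_mod (C : comNzRingType) (p q x f : C) : Prop :=
  exists g, exists u v w, g * f = 1 + u * p + v * q + w * x.

Section Transform.
Variables (R : comNzRingType) (x a a1 b b1 b2 : R).
Variables (P : {poly R}) (Q g : {poly {poly R}}).
Hypotheses (aE : a = x * a1) (bE : b = x * b1) (b1E : b1 = x * b2).

(** The S-points over j of R[Y, Z, T] / (a Y - P, b T - Q). *)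
Definition dd_point (a b : R) (S : comNzRingType) (j : {rmorphism R -> S})
    (z y t : S) :=
  j a * y = eval_at j z P /\ j b * t = eval_at (eval_at j z) y Q.

(** The S-points of the fibre product of the two torsors: the first equation is
    the translation of z under the additive group, the second the coordinate w
    that trivializes the torsor over L'. *)
Definition dd_corr (S : comNzRingType) (j : {rmorphism R -> S})
    (z v z' y' t' w : S) :=
  z' = z + j (a * b1) * v /\
  v = eval_at (eval_at j z') y' g * t' + j x * w.

Variables (cP cQ cx : {poly {poly R}}).
Hypothesis gE : g * (P^`()%:P * Q^`()) = 1 + cP * P%:P + cQ * Q + cx * x%:P%:P.
Variables (S : comNzRingType) (j : {rmorphism R -> S}).

(** At a point of the algebra, P = a y and Q = x c t are multiples of x, so that
    invertibility modulo (P, Q, x) becomes invertibility modulo x. *)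
Lemma eval_slope_inv c z y t : dd_point a (x * c) j z y t ->
  exists h, eval_at (eval_at j z) y g
    * (eval_at j z P^`() * eval_at (eval_at j z) y Q^`()) = 1 + j x * h.
Proof.
case=> aP bQ; have /(congr1 (eval_at (eval_at j z) y)) := gE.
rewrite !rmorphM !rmorphD !rmorphM rmorph1 /= !eval_atC -aP -bQ => ->.
set U := eval_at _ _ cP; set V := eval_at _ _ cQ; set W := eval_at _ _ cx.
exists (U * j a1 * y + V * j c * t + W).
by rewrite aE; ring.
Qed.

(** By Taylor expansion t' = x t + s P' Q' modulo x s, hence g t' = s modulo x,
    which is what makes w' = (s - g t') / x exist. *)
Lemma dd_corr_down z y t s : dd_point a b j z y t ->
  exists z' y' t' w', dd_point a b1 j z' y' t' /\ dd_corr j z s z' y' t' w'.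
Proof.
move=> pt; have [aP bQ] := pt.
move: pt; rewrite bE => /eval_slope_inv[h hE].
pose c := j (a * b1) * s.
have [r PE] := taylor2 j z c P.
pose m := eval_at j z P^`() + c * r.
have [r1 [r2 QE]] := taylor_xy j z c y (j b1 * s * m) Q.
have [r3 [r4 gE1]] := taylor_xy j z c y (j b1 * s * m) g.
set P' := eval_at j z P^`() in hE PE m QE gE1.
set Q' := eval_at _ _ Q^`() in QE hE.
set G := eval_at (eval_at j z) y g in gE1 hE.
set G' := eval_at _ _ g^`() in gE1.
(* m is the slope of y, and m * Q' + ... the slope of t, which is P' Q' mod x. *)
have [m0 m0E] : exists m0, m * Q' + j b1 * s * m ^+ 2 * r2 + j a * r1
    = P' * Q' + j x * m0.
  exists (j a1 * j b1 * s * r * Q' + j b2 * s * m ^+ 2 * r2 + j a1 * r1).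
  by rewrite /m /c b1E aE; ring.
pose t' := j x * t + s * (P' * Q' + j x * m0).
(* g(z', y') = g(z, y) + x k *)
pose k := j b2 * s * m * G' + j a1 * j b1 * s * r3
  + j b1 * j b2 * (s * m) ^+ 2 * r4.
exists (z + c), (y + j b1 * s * m), t'.
exists (- (G * t + s * h + G * s * m0 + k * t')).
split; split=> //.
- by rewrite PE -aP /m /c; ring.
- by rewrite QE -bQ /t' -m0E bE /c; ring.
- rewrite gE1.
  have -> : G + j b1 * s * m * G' + c * r3 + (j b1 * s * m) ^+ 2 * r4
    = G + j x * k.
    by rewrite /k /c aE b1E; ring.
  transitivity (s * (1 + j x * h) - s * j x * h); first by ring.
  by rewrite -hE /t'; ring.
Qed.

(** Here z is translated by - a b1 s, and the coordinate that must be divided by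
    x is t: t' - s P' Q' vanishes modulo x because s = g t' modulo
    x and g P' Q' = 1 modulo x. *)
Lemma dd_corr_up z' y' t' w : dd_point a b1 j z' y' t' ->
  exists z y t s, dd_point a b j z y t /\ dd_corr j z s z' y' t' w.
Proof.
move=> pt; have [aP bQ] := pt.
move: pt; rewrite b1E => /eval_slope_inv[h hE].
set G := eval_at _ _ g in hE.
pose s := G * t' + j x * w.
pose c := j (a * b1) * s.
have [r PE] := taylor2 j z' (- c) P.
pose m := eval_at j z' P^`() - c * r.
have [r1 [r2 QE]] := taylor_xy j z' (- c) y' (- (j b1 * s * m)) Q.
set P' := eval_at j z' P^`() in hE PE m QE.
set Q' := eval_at _ _ Q^`() in QE hE.
have [m0 m0E] : exists m0, m * Q' - j b1 * s * m ^+ 2 * r2 + j a * r1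
    = P' * Q' + j x * m0.
  exists (- (j a1 * j b1 * s * r * Q') - j b2 * s * m ^+ 2 * r2 + j a1 * r1).
  by rewrite /m /c b1E aE; ring.
exists (z' - c), (y' - j b1 * s * m), (- (h * t' + w * P' * Q' + s * m0)), s.
split; split=> //.
- by rewrite PE -aP /m /c; ring.
- rewrite QE -bQ.
  have -> : j b1 * t' + - (j b1 * s * m) * Q' + - c * r1
    + (- (j b1 * s * m)) ^+ 2 * r2
    = j b1 * (t' - s * (m * Q' - j b1 * s * m ^+ 2 * r2 + j a * r1)).
    by rewrite /c; ring.
  rewrite m0E bE.
  have -> : t' - s * (P' * Q' + j x * m0)
    = t' - t' * (G * (P' * Q')) - j x * (w * P' * Q' + s * m0) by rewrite /s; ring.
  by rewrite hE; ring.
- by rewrite /c; ring.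
Qed.

End Transform.

(** * The stable isomorphism from universal properties *)

(** B represents points (z, y, t) together with a free coordinate v, that is, B
    is the polynomial ring in one variable over the double Danielewski
    algebra. *)
Definition dd_universal (R : comNzRingType) (P : {poly R}) (Q : {poly {poly R}})
    (a b : R) (B : comNzRingType) (i : {rmorphism R -> B}) (Z Y T V : B) : Prop :=
  [/\ dd_point P Q a b i Z Y T,
      forall (S : comNzRingType) (j : {rmorphism R -> S}) z y t v,
        dd_point P Q a b j z y t ->
        exists f : {rmorphism B -> S},
          [/\ forall c, f (i c) = j c, f Z = z, f Y = y, f T = t & f V = v]
    & forall (S : comNzRingType) (f g : {rmorphism B -> S}),
        (forall c, f (i c) = g (i c)) ->
        f Z = g Z -> f Y = g Y -> f T = g T -> f V = g V -> f =1 g].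

Section StableIsomorphism.
Variables (R : comNzRingType) (x a a1 b b1 b2 : R).
Variables (P : {poly R}) (Q : {poly {poly R}}).
Hypotheses (aE : a = x * a1) (bE : b = x * b1) (b1E : b1 = x * b2).
Hypothesis slope_unit : unit_mod P%:P Q x%:P%:P (P^`()%:P * Q^`()).

Variables (B B' : comNzRingType) (i : {rmorphism R -> B}) (i' : {rmorphism R -> B'}).
Variables (Z Y T V : B) (Z' Y' T' W : B').
Hypothesis B_univ : dd_universal P Q a b i Z Y T V.
Hypothesis B'_univ : dd_universal P Q a b1 i' Z' Y' T' W.
Hypotheses (a_reg : GRing.lreg (i a)) (b_reg : GRing.lreg (i b)).
Hypotheses (a_reg' : GRing.lreg (i' a)) (b1_reg' : GRing.lreg (i' b1)).
Hypothesis x_reg' : GRing.lreg (i' x).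

Lemma dd_point_morph (S S' : comNzRingType) (j : {rmorphism R -> S})
    (j' : {rmorphism R -> S'}) (f : {rmorphism S -> S'}) c z y t :
  (forall r, f (j r) = j' r) -> dd_point P Q a c j z y t ->
  dd_point P Q a c j' (f z) (f y) (f t).
Proof.
move=> fj [aP bQ]; split; rewrite -fj -rmorphM ?aP ?bQ.
  exact: rmorph_eval.
by apply: rmorph_eval => p; exact: rmorph_eval.
Qed.

(** y and t are the fractions P(z) / a and Q(z, y) / c. *)
Lemma dd_point_unique (S : comNzRingType) (j : {rmorphism R -> S}) c z y t y' t' :
  GRing.lreg (j a) -> GRing.lreg (j c) ->
  dd_point P Q a c j z y t -> dd_point P Q a c j z y' t' -> y = y' /\ t = t'.
Proof.
move=> a_inj c_inj [aP cQ] [aP' cQ'].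
have yE : y = y' by apply: a_inj; rewrite aP aP'.
by split=> //; apply: c_inj; rewrite cQ cQ' yE.
Qed.

(** Applying the correspondence to the generic point of B' gives f : B -> B' and
    to that of B gives h : B' -> B. The formula for v shows that h (f V) = V, and
    then the translations of Z and Z' cancel; the other coordinates are quotients
    by regular elements, hence determined by these. *)
Lemma stable_iso : exists f : {rmorphism B -> B'},
  bijective f /\ forall c, f (i c) = i' c.
Proof.
have [g [cP [cQ [cx gE]]]] := slope_unit.
have [B_pt B_lift B_ext] := B_univ; have [B'_pt B'_lift B'_ext] := B'_univ.
have [z [y [t [s [pt [ZE sE]]]]]] := dd_corr_up aE bE b1E gE W B'_pt.
have [z' [y' [t' [w [pt' [z'E VE]]]]]] := dd_corr_down aE bE b1E gE V B_pt.
have [f [fi fZ fY fT fV]] := B_lift _ _ _ _ _ s pt.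
have [h [hi hZ hY hT hW]] := B'_lift _ _ _ _ _ w pt'.
have hs : h s = V.
  rewrite sE VE !rmorphD !rmorphM hT hW hi; congr (_ * _ + _).
  rewrite -hZ -hY; rewrite (rmorph_eval (j' := eval_at i (h Z'))) //.
  by move=> p; exact: rmorph_eval.
have hz : h z = Z.
  by apply: (addIr (i (a * b1) * V)); rewrite -z'E -hs -hi -rmorphM -rmorphD -ZE.
have [hy ht] : h y = Y /\ h t = T.
  apply: (@dd_point_unique _ i b Z) => //; rewrite -hz.
  exact: dd_point_morph pt.
have fz' : f z' = Z' by rewrite z'E rmorphD rmorphM fi fZ fV -ZE.
have [fy' ft'] : f y' = Y' /\ f t' = T'.
  apply: (@dd_point_unique _ i' b1 Z') => //; rewrite -fz'.
  exact: dd_point_morph pt'.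
have fw : f w = W.
  apply: x_reg'; have := congr1 f VE; rewrite fV rmorphD !rmorphM fi ft'.
  have -> : f (eval_at (eval_at i z') y' g) = eval_at (eval_at i' Z') Y' g.
    rewrite -fz' -fy'; apply: rmorph_eval => p; exact: rmorph_eval.
  by rewrite {1}sE => /addrI.
exists f; split=> //; exists h.
  by apply: (B_ext _ (h \o f) idfun) => [c|||| ] /=; rewrite ?fi ?fZ ?fY ?fT ?fV ?hi.
by apply: (B'_ext _ (f \o h) idfun) => [c|||| ] /=; rewrite ?hi ?hZ ?hY ?hT ?hW ?fi.
Qed.

End StableIsomorphism.

(** * Finitely generated ideals and monic polynomials *)

Section IdealGenTheory.
Variable R : comNzRingType.
Implicit Types (s : seq R) (x y c p q : R).

Lemma ideal_genD s x y :
  x \in ideal_gen s -> y \in ideal_gen s -> x + y \in ideal_gen s.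
Proof.
move=> /ideal_genP[c ->] /ideal_genP[c' ->]; apply/ideal_genP.
exists (fun i => c i + c' i); rewrite -big_split.
by apply: eq_bigr => i _; rewrite mulrDl.
Qed.

Lemma ideal_genMl s c x : x \in ideal_gen s -> c * x \in ideal_gen s.
Proof.
move=> /ideal_genP[c' ->]; apply/ideal_genP.
exists (fun i => c * c' i); rewrite mulr_sumr.
by apply: eq_bigr => i _; rewrite mulrA.
Qed.

Lemma ideal_gen_sum (I : Type) (r : seq I) (D : pred I) (F : I -> R) s :
  (forall i, D i -> F i \in ideal_gen s) -> \sum_(i <- r | D i) F i \in ideal_gen s.
Proof.
move=> Fs; elim/big_ind: _ => //; last exact: ideal_genD.
by apply/ideal_genP; exists (fun=> 0); rewrite big1 // => i _; rewrite mul0r.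
Qed.

Lemma ideal_gen2P p q x :
  x \in ideal_gen [:: p; q] <-> exists u v, x = u * p + v * q.
Proof.
split=> [/ideal_genP[c ->]|[u [v ->]]].
  by exists (c ord0), (c (lift ord0 ord0)); rewrite !big_ord_recl big_ord0 /= addr0.
apply/ideal_genP; exists (fun i : 'I_2 => if i == ord0 then u else v).
by rewrite !big_ord_recl big_ord0 /= addr0.
Qed.

Lemma ideal_gen3P p q r x :
  x \in ideal_gen [:: p; q; r] <-> exists u v w, x = u * p + v * q + w * r.
Proof.
split=> [/ideal_genP[c ->]|[u [v [w ->]]]].
  exists (c ord0), (c (lift ord0 ord0)), (c (lift ord0 (lift ord0 ord0))).
  by rewrite !big_ord_recl big_ord0 /= addr0 addrA.
apply/ideal_genP; exists (fun i : 'I_3 => [:: u; v; w]`_i).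
by rewrite !big_ord_recl big_ord0 /= addr0 addrA.
Qed.

End IdealGenTheory.

Lemma ideal_gen1P (R : comNzRingType) (p x : R) :
  x \in ideal_gen [:: p] <-> exists u, x = u * p.
Proof.
split=> [/ideal_genP[c ->]|[u ->]]; first by exists (c ord0); rewrite big_ord1.
by apply/ideal_genP; exists (fun=> u); rewrite big_ord1.
Qed.

Section IdealGenPoly.
Variable R : comNzRingType.
Implicit Types (s : seq R) (x p q : R).

(** A monic polynomial is a nonzerodivisor modulo any ideal s of the coefficient
    ring: the coefficient of q h of index i plus the degree of q is h_i plus a
    combination of coefficients of h of larger index, so that descending
    induction on i applies. *)
Lemma monic_nzd_mod_ideal s (q h : {poly R}) : q \is monic ->
  (forall i, (q * h)`_i \in ideal_gen s) -> forall i, h`_i \in ideal_gen s.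
Proof.
move=> q_monic qh i.
have [m] := ubnP (size h - i); elim: m i => // m IH i lt_m.
have ideal0 : 0 \in ideal_gen s by have := ideal_genMl 0 (qh 0%N); rewrite mul0r.
have [le_h|lt_h] := leqP (size h) i; first by rewrite nth_default.
pose l := (size q).-1.
have q0 : (0 < size q)%N by rewrite size_poly_gt0 monic_neq0.
have lt_l : (l < (i + l).+1)%N by rewrite ltnS leq_addl.
pose rest := \sum_(j < (i + l).+1 | j != Ordinal lt_l) q`_j * h`_(i + l - j).
have qhE : (q * h)`_(i + l)%N = h`_i + rest.
  rewrite coefM (bigD1 (Ordinal lt_l)) //= addnK.
  by rewrite -[q`_l]/(lead_coef q) (monicP q_monic) mul1r.
have -> : h`_i = (q * h)`_(i + l)%N + -1 * rest.
  by rewrite qhE; ring.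
apply: ideal_genD; first exact: qh.
apply/ideal_genMl/ideal_gen_sum => j neq_jl.
have [lt_lj|lt_jl|eq_jl] := ltngtP l j.
- by rewrite nth_default ?mul0r // -(prednK q0).
- apply/ideal_genMl/IH; move: lt_m lt_h; rewrite -addnBA ?(ltnW lt_jl) //.
  rewrite -subn_gt0 in lt_jl.
  move=> lt_m lt_h; rewrite ltnS in lt_m; apply: leq_trans lt_m.
  by rewrite ltn_sub2l // -[X in (X < _)%N]addn0 ltn_add2l.
- by case/eqP: neq_jl; exact: val_inj.
Qed.

(** Testing an extended ideal coefficientwise makes regularity modulo an ideal
    available in iterated polynomial rings without forming quotient rings. *)
Lemma ideal_gen1_coef x (h : {poly R}) :
  h \in ideal_gen [:: x%:P] <-> forall i, h`_i \in ideal_gen [:: x].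
Proof.
split=> [/ideal_gen1P[u ->] i|hx].
  by apply/ideal_gen1P; exists u`_i; rewrite coefMC.
have /choice[u uE] i : exists u, h`_i = u * x by exact/ideal_gen1P.
apply/ideal_gen1P; exists (\poly_(i < size h) u i); apply/polyP => i.
by rewrite coefMC coef_poly; case: ltnP => [//|le_h]; rewrite nth_default ?mul0r.
Qed.

Lemma ideal_gen2_coef p q (h : {poly R}) :
  h \in ideal_gen [:: p%:P; q%:P] <-> forall i, h`_i \in ideal_gen [:: p; q].
Proof.
split=> [/ideal_gen2P[u [v ->]] i|hpq].
  by apply/ideal_gen2P; exists u`_i, v`_i; rewrite coefD !coefMC.
have /choice[u uE] i : exists u, exists v, h`_i = u * p + v * q by exact/ideal_gen2P.
have /choice[v vE] := uE.
apply/ideal_gen2P; exists (\poly_(i < size h) u i), (\poly_(i < size h) v i).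
apply/polyP => i; rewrite coefD !coefMC !coef_poly.
by case: ltnP => [_|le_h]; rewrite -?vE // nth_default //; ring.
Qed.

End IdealGenPoly.

Lemma lreg_polyC (R : nzRingType) (c : R) : GRing.lreg c -> GRing.lreg c%:P.
Proof.
move=> c_reg; apply: mulrI0_lreg => p /polyP cp0; apply/polyP => i.
by apply: c_reg; rewrite coef0 mulr0 -coefCM cp0 coef0.
Qed.

(** * Universal property of the double quotient *)

Section DquotTheory.
Variables (A : idomainType) (a b : A) (a0 : a != 0) (b0 : b != 0).
Variables (p : A) (q : {poly A}).
Local Notation L := (dquot_ring a0 b0 p q).
Local Notation pi := (dquot_pi a0 b0 p q).

Lemma dquot_pi_eq0 f : pi f = 0 <-> f \in ideal_gen (dquot_gens a b p q).
Proof.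
have := Quotient.idealrBE (dquot_ideal p q a0 b0) f 0.
rewrite subr0 => E; rewrite -[f \in _]/(f \in dquot_ideal p q a0 b0) E.
rewrite -(rmorph0 pi); exact: (rwP eqP).
Qed.

Lemma dquot_relations :
  pi a%:P%:P * pi 'X%:P = pi p%:P%:P /\ pi b%:P%:P * pi 'X = pi q%:P.
Proof.
split; rewrite -rmorphM; apply/eqP; rewrite -subr_eq0 -rmorphB; apply/eqP.
  apply/dquot_pi_eq0/ideal_gen2P; exists 1, 0.
  by rewrite mul0r addr0 mul1r rmorphB rmorphM.
by apply/dquot_pi_eq0/ideal_gen2P; exists 0, 1; rewrite mul0r add0r mul1r.
Qed.

Lemma dquot_pi_surj l : exists f, l = pi f.
Proof. by exists (repr l); rewrite /dquot_pi /= reprK. Qed.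

Section Lift.
Variables (S : comNzRingType) (g : {rmorphism {poly {poly A}} -> S}).
Hypotheses (g1 : g (a%:P * 'X - p%:P)%:P = 0) (g2 : g (b%:P%:P * 'X - q%:P) = 0).

Let lift (l : L) : S := g (repr l).

Let lift_pi f : lift (pi f) = g f.
Proof.
apply/eqP; rewrite -subr_eq0 -rmorphB; apply/eqP.
have /dquot_pi_eq0/ideal_gen2P[u [v ->]] : pi (repr (pi f) - f) = 0.
  by rewrite rmorphB /dquot_pi /= reprK subrr.
by rewrite rmorphD !rmorphM /= g1 g2 !mulr0 addr0.
Qed.

Let lift_is_zmod : zmod_morphism lift.
Proof.
move=> l l'; have [[f ->] [f' ->]] := (dquot_pi_surj l, dquot_pi_surj l').
by rewrite -rmorphB !lift_pi rmorphB.
Qed.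

Let lift_is_monoid : monoid_morphism lift.
Proof.
split=> [|l l']; first by rewrite -(rmorph1 pi) lift_pi rmorph1.
have [[f ->] [f' ->]] := (dquot_pi_surj l, dquot_pi_surj l').
by rewrite -rmorphM !lift_pi rmorphM.
Qed.

HB.instance Definition _ := GRing.isZmodMorphism.Build L S lift lift_is_zmod.
HB.instance Definition _ := GRing.isMonoidMorphism.Build L S lift lift_is_monoid.

Lemma dquot_lift : exists f : {rmorphism L -> S}, forall h, f (pi h) = g h.
Proof. by exists lift; exact: lift_pi. Qed.

End Lift.
End DquotTheory.

Section Presentation.
Variables (R : idomainType) (a b : R).
Variables (a0 : a%:P != 0 :> {poly R}) (b0 : b%:P != 0 :> {poly R}).
Variables (P : {poly R}) (Q : {poly {poly R}}).
Local Notation L := (dquot_ring a0 b0 P Q).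
Local Notation pi := (dquot_pi a0 b0 P Q).

(** The next three identities deal with a relation X f = h1 g1 + h2 g2 between
    g1 = X A1 Y - p and g2 = X B1 T - q. Modulo X it reads h1 p + h2 q = 0, so if
    X, p, q is a regular sequence, (h1, h2) is modulo X a multiple m (- q, p) of
    the Koszul syzygy. As p g2 - q g1 = X (A1 Y g2 - B1 T g1), one can then
    divide by X. *)
Lemma koszul_snd (C : comNzRingType) (X A1 B1 Y T p q h1 h2 f : C) :
  X * f = h1 * (X * A1 * Y - p) + h2 * (X * B1 * T - q) ->
  q * h2 = - h1 * p + (h1 * A1 * Y + h2 * B1 * T - f) * X.
Proof.
move=> E; transitivity (q * h2 + (X * f - X * f)); first by ring.
by rewrite {1}E; ring.
Qed.

Lemma koszul_fst (C : comNzRingType) (X A1 B1 Y T p q h1 h2 m n f : C) :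
  X * f = h1 * (X * A1 * Y - p) + h2 * (X * B1 * T - q) -> h2 = m * p + n * X ->
  p * (h1 + q * m) = (h1 * A1 * Y + h2 * B1 * T - n * q - f) * X.
Proof.
move=> E h2E; transitivity (p * (h1 + q * m) + (X * f - X * f)); first by ring.
by rewrite {1}E h2E; ring.
Qed.

Lemma koszul_divide (C : idomainType) (X A1 B1 Y T p q h1 h2 m n r f : C) :
  X != 0 -> X * f = h1 * (X * A1 * Y - p) + h2 * (X * B1 * T - q) ->
  h2 = m * p + n * X -> h1 + q * m = r * X ->
  f = (r - m * B1 * T) * (X * A1 * Y - p) + (n + m * A1 * Y) * (X * B1 * T - q).
Proof.
move=> X0 E h2E h1E; apply: (mulfI X0); rewrite E h2E.
have -> : h1 = r * X - q * m by rewrite -h1E; ring.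
by ring.
Qed.

(** x, P, Q is a regular sequence in R[Z][Y][T], as P and Q are monic in different
    variables. *)
Lemma dquot_lreg x a1 b1 : x != 0 -> a = x * a1 -> b = x * b1 ->
  P \is monic -> Q \is monic -> GRing.lreg (pi x%:P%:P%:P).
Proof.
move=> x0 aE bE Pm Qm; apply: mulrI0_lreg => l; have [f ->] := dquot_pi_surj l.
rewrite -rmorphM => /dquot_pi_eq0/ideal_gen2P[h1 [h2 E]].
apply/dquot_pi_eq0/ideal_gen2P; move: E.
rewrite aE bE !rmorphB !rmorphM /=.
set X := x%:P%:P%:P; set Y := 'X%:P; set T := 'X.
set A1 := a1%:P%:P%:P; set B1 := b1%:P%:P%:P => E.
have /ideal_gen2P[m [n h2E]] : h2 \in ideal_gen [:: P%:P%:P; X].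
  apply/ideal_gen2_coef => i; apply/ideal_gen2_coef; apply: (monic_nzd_mod_ideal Qm).
  apply/ideal_gen2_coef; rewrite -coefCM; move: i; apply/ideal_gen2_coef.
  by apply/ideal_gen2P; rewrite (koszul_snd E); do 2!eexists.
have /ideal_gen1P[r h1E] : h1 + Q%:P * m \in ideal_gen [:: X].
  apply/ideal_gen1_coef => i; apply/ideal_gen1_coef => k; apply/ideal_gen1_coef.
  apply: (monic_nzd_mod_ideal Pm); apply/ideal_gen1_coef.
  rewrite -coefCM; move: k; apply/ideal_gen1_coef.
  rewrite -coefCM; move: i; apply/ideal_gen1_coef.
  by apply/ideal_gen1P; rewrite (koszul_fst E h2E); eexists.
exists (r - m * B1 * T), (n + m * A1 * Y).
by apply: (koszul_divide _ E h2E h1E); rewrite !polyC_eq0.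
Qed.

(** The structure morphism over R of L[V]. *)
Definition dd_base : {rmorphism R -> {poly L}} :=
  polyC \o pi \o polyC \o polyC \o polyC.

Local Notation Zb := (pi 'X%:P%:P)%:P.
Local Notation Yb := (pi 'X%:P)%:P.
Local Notation Tb := (pi 'X)%:P.

Lemma dd_baseE c : dd_base c = (pi c%:P%:P%:P)%:P.
Proof. by []. Qed.

Lemma eval_dd_baseZ p : eval_at dd_base Zb p = (pi p%:P%:P)%:P.
Proof.
pose h : {rmorphism {poly R} -> {poly L}} := polyC \o pi \o polyC \o polyC.
apply: (@rmorph_poly_ext _ _ (eval_at dd_base Zb) h) => [c|].
  by rewrite eval_atC.
by rewrite eval_atX.
Qed.

Lemma eval_dd_baseYZ q : eval_at (eval_at dd_base Zb) Yb q = (pi q%:P)%:P.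
Proof.
pose h : {rmorphism {poly {poly R}} -> {poly L}} := polyC \o pi \o polyC.
apply: (@rmorph_poly_ext _ _ (eval_at _ Yb) h) => [c|].
  by rewrite eval_atC eval_dd_baseZ.
by rewrite eval_atX.
Qed.

Lemma dd_point_universal : dd_point P Q a b dd_base Zb Yb Tb.
Proof.
have [Y_rel T_rel] := dquot_relations a0 b0 P Q.
split.
- by rewrite eval_dd_baseZ -Y_rel dd_baseE polyCM.
- by rewrite eval_dd_baseYZ -T_rel dd_baseE polyCM.
Qed.

Lemma dd_lift (S : comNzRingType) (j : {rmorphism R -> S}) z y t v :
  dd_point P Q a b j z y t ->
  exists f : {rmorphism {poly L} -> S},
    [/\ forall c, f (dd_base c) = j c, f Zb = z, f Yb = y, f Tb = t & f 'X = v].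
Proof.
case=> aP bQ.
have [|/=|f fE] := @dquot_lift _ _ _ a0 b0 P Q _ (eval_at (eval_at (eval_at j z) y) t).
- by rewrite eval_atC !(rmorphB, rmorphM) /= eval_atX !eval_atC aP subrr.
- by rewrite !(rmorphB, rmorphM) /= eval_atX !eval_atC bQ subrr.
exists (eval_at f v); split=> [c||||]; last by rewrite eval_atX.
- by rewrite dd_baseE eval_atC fE !eval_atC.
- by rewrite eval_atC fE !eval_atC eval_atX.
- by rewrite eval_atC fE eval_atC eval_atX.
- by rewrite eval_atC fE eval_atX.
Qed.

Lemma dd_ext (S : comNzRingType) (f g : {rmorphism {poly L} -> S}) :
  (forall c, f (dd_base c) = g (dd_base c)) ->
  f Zb = g Zb -> f Yb = g Yb -> f Tb = g Tb -> f 'X = g 'X -> f =1 g.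
Proof.
move=> fg_base; apply: rmorph_quot_ext => [l|c]; first exact: dquot_pi_surj.
by rewrite -dd_baseE.
Qed.

Lemma dquot_universal : dd_universal P Q a b dd_base Zb Yb Tb 'X.
Proof. by split; [exact: dd_point_universal|exact: dd_lift|exact: dd_ext]. Qed.

Lemma dd_base_lreg x a1 b1 : x != 0 -> a = x * a1 -> b = x * b1 ->
  P \is monic -> Q \is monic -> GRing.lreg (dd_base x).
Proof.
move=> x0 aE bE Pm Qm; rewrite dd_baseE; apply: lreg_polyC.
exact: dquot_lreg aE bE Pm Qm.
Qed.

End Presentation.

(** * Comaximality along the divisor x = 0 *)

Section UnitMod.
Variables (C : comNzRingType) (p q : C).

Lemma unit_modM x f1 f2 :
  unit_mod p q x f1 -> unit_mod p q x f2 -> unit_mod p q x (f1 * f2).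
Proof.
move=> [g1 [u1 [v1 [w1 E1]]]] [g2 [u2 [v2 [w2 E2]]]].
set c := 1 + u2 * p + v2 * q + w2 * x in E2.
exists (g1 * g2), (u1 * c + u2), (v1 * c + v2), (w1 * c + w2).
by rewrite mulrACA E1 E2 /c; ring.
Qed.

(** If g f = 1 modulo (p, q, y) and g' f = 1 modulo (p, q, y'), the product of
    g f - 1 and g' f - 1 shows that f is invertible modulo (p, q, y y'). *)
Lemma unit_mod_prod (I : finType) (x : I -> C) f :
  (forall i, unit_mod p q (x i) f) -> unit_mod p q (\prod_i x i) f.
Proof.
move=> f_unit; elim/big_rec: _ => [|i y _ [g [u [v [w E]]]]].
  by exists 0, 0, 0, (-1); ring.
have [g' [u' [v' [w' E']]]] := f_unit i.
exists ((1 + u * p + v * q) * g' - g * w' * x i).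
exists (u + u' + u * u' * p + u * v' * q + v * u' * q), (v + v' + v * v' * q).
exists (- (w * w')).
transitivity ((1 + u * p + v * q) * (g' * f) - (g * f) * w' * x i); first by ring.
by rewrite E E'; ring.
Qed.

End UnitMod.

Lemma map_poly_shift (R : comNzRingType) (F : {rmorphism R -> R}) (x : R) :
  (forall c, exists r, F c = c + x * r) ->
  forall p, exists r, map_poly F p = p + x%:P * r.
Proof.
move=> Fx p; elim/poly_ind: p => [|p c [r IH]].
  by exists 0; rewrite rmorph0; ring.
have [s Fc] := Fx c; exists (r * 'X + s%:P).
by rewrite rmorphD rmorphM /= map_polyX map_polyC /= IH Fc rmorphD rmorphM; ring.
Qed.

Section SetX0Lift.
Variables (k : fieldType) (n : nat) (i : 'I_n).

Let s : {rmorphism {mpoly k[n]} -> {mpoly k[n.-1]}} :=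
  comp_mpoly [tuple if unlift i j is Some j' then 'X_j' else 0 | j < n].

(** A section of [setX0 i]; the composite [insertX \o setX0 i] is the identity
    modulo X_i, so that identities over the hyperplane X_i = 0 lift to identities
    modulo X_i. *)
Definition insertX : {rmorphism {mpoly k[n.-1]} -> {mpoly k[n]}} :=
  comp_mpoly [tuple 'X_(lift i j) | j < n.-1].

Lemma insertX_setX0 p : exists r, insertX (setX0 i p) = p + 'X_i * r.
Proof.
rewrite -[setX0 i p]/(s p).
pose lifts q := exists r, insertX (s q) = q + 'X_i * r.
have liftsD q q' : lifts q -> lifts q' -> lifts (q + q').
  by move=> [r E] [r' E']; exists (r + r'); rewrite !rmorphD E E' mulrDr addrACA.
have liftsM q q' : lifts q -> lifts q' -> lifts (q * q').
  move=> [r E] [r' E']; exists (q * r' + r * q' + 'X_i * r * r').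
  by rewrite !rmorphM E E'; ring.
have liftsC c : lifts c%:MP.
  by exists 0; rewrite /insertX /s /= !comp_mpolyC mulr0 addr0.
have lifts1 : lifts 1 by rewrite -(mpolyC1 n).
have liftsX j : lifts 'X_j.
  rewrite /lifts /insertX /s /= comp_mpolyXU -tnth_nth tnth_mktuple.
  case: unliftP => [j' ->|->].
    by exists 0; rewrite comp_mpolyXU -tnth_nth tnth_mktuple mulr0 addr0.
  by exists (-1); rewrite rmorph0; ring.
rewrite -/(lifts p); elim/mpolyind: p => [|c m p _ _ IH].
  by rewrite -(mpolyC0 n); exact: liftsC.
apply: liftsD IH; rewrite -mul_mpolyC; apply: (liftsM) => //.
rewrite mpolyXE_id; apply: (big_ind lifts lifts1 liftsM) => j _.
by elim: (m j) => [|d IH]; [|rewrite exprS; exact: liftsM].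
Qed.

Lemma unit_mod_derivP (P : {poly {mpoly k[n]}}) q :
  is_unit_ideal [:: map_poly (setX0 i) P; map_poly (setX0 i) P^`()] ->
  unit_mod P%:P q ('X_i)%:P%:P P^`()%:P.
Proof.
move=> /(_ 1)/ideal_gen2P[u [v]].
rewrite -[setX0 i]/(s : _ -> _).
have lift0 := map_poly_shift (F := insertX \o s) insertX_setX0.
pose m : {rmorphism {poly {mpoly k[n.-1]}} -> {poly {mpoly k[n]}}} :=
  map_poly insertX.
have mE f : m (map_poly s f) = map_poly (insertX \o s) f.
  by rewrite /m /= -map_poly_comp.
move/(congr1 m).
rewrite rmorph1 rmorphD !rmorphM /= !mE.
have [[r ->] [r' ->]] := (lift0 P, lift0 P^`()) => E.
exists (m v)%:P, (- m u)%:P, 0, (- (m u * r + m v * r'))%:P.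
rewrite mul0r addr0 -!polyCM -polyC1 -!polyCD; congr (_%:P).
by rewrite {}E; ring.
Qed.

Lemma unit_mod_derivQ (P : {poly {mpoly k[n]}}) (Q : {poly {poly {mpoly k[n]}}}) :
  is_unit_ideal [:: (map_poly (setX0 i) P)%:P;
                    map_poly (map_poly (setX0 i)) Q;
                    map_poly (map_poly (setX0 i)) Q^`()] ->
  unit_mod P%:P Q ('X_i)%:P%:P Q^`().
Proof.
move=> /(_ 1)/ideal_gen3P[u [v [w]]].
rewrite -[setX0 i]/(s : _ -> _).
have lift0 := map_poly_shift (F := insertX \o s) insertX_setX0.
have lift1 := map_poly_shift (F := map_poly (insertX \o s)) lift0.
pose m : {rmorphism {poly {poly {mpoly k[n.-1]}}} -> {poly {poly {mpoly k[n]}}}} :=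
  map_poly (map_poly insertX).
have mE f : m (map_poly (map_poly s) f) = map_poly (map_poly (insertX \o s)) f.
  rewrite /m /= -map_poly_comp; apply: eq_map_poly => c /=.
  by rewrite -map_poly_comp.
have mC f : m (map_poly s f)%:P = (map_poly (insertX \o s) f)%:P.
  by rewrite /m /= map_polyC /= -map_poly_comp.
move/(congr1 m).
rewrite rmorph1 !rmorphD !rmorphM /= !mE mC.
have [[r0 ->] [r ->] [r' ->]] := And3 (lift0 P) (lift1 Q) (lift1 Q^`()) => E.
exists (m w), (- m u), (- m v), (- (m u * r0%:P + m v * r + m w * r')).
by rewrite {}E polyCD polyCM; ring.
Qed.

End SetX0Lift.

Section ConcreteStableIsomorphism.
Variables (R : idomainType) (x a a1 b b1 b2 : R).
Variables (a0 : a%:P != 0 :> {poly R}) (b0 : b%:P != 0 :> {poly R}).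
Variable b10 : b1%:P != 0 :> {poly R}.
Variables (P : {poly R}) (Q : {poly {poly R}}).
Hypotheses (aE : a = x * a1) (bE : b = x * b1) (b1E : b1 = x * b2).
Hypothesis slope_unit : unit_mod P%:P Q x%:P%:P (P^`()%:P * Q^`()).
Hypothesis a_reg : GRing.lreg (dd_base a0 b0 P Q a).
Hypothesis b_reg : GRing.lreg (dd_base a0 b0 P Q b).
Hypothesis a_reg' : GRing.lreg (dd_base a0 b10 P Q a).
Hypothesis b1_reg' : GRing.lreg (dd_base a0 b10 P Q b1).
Hypothesis x_reg' : GRing.lreg (dd_base a0 b10 P Q x).

Lemma dquot_stable_iso (k : comNzRingType) (iota : {rmorphism k -> R}) :
  algebras_isomorphic (dquot_poly_const a0 b0 P Q (polyC \o iota))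
    (dquot_poly_const a0 b10 P Q (polyC \o iota)).
Proof.
have [f [f_bij fE]] := stable_iso aE bE b1E slope_unit (dquot_universal a0 b0 P Q)
  (dquot_universal a0 b10 P Q) a_reg b_reg a_reg' b1_reg' x_reg'.
by exists f; split=> // c; exact: (fE (iota c)).
Qed.

End ConcreteStableIsomorphism.

(** * Monomials and the theorem *)

Section Monomials.
Variables (k : fieldType) (n : nat).
Implicit Types m d e : 'X_{1..n}.

Lemma mpolyX_pred m : (forall i, 1 <= m i)%N ->
  'X_[m] = (\prod_i 'X_i) * 'X_[[multinom (m i).-1 | i < n]] :> {mpoly k[n]}.
Proof.
move=> m_gt0; rewrite !mpolyXE_id -big_split; apply: eq_bigr => i _.
by rewrite mnmE /= -exprS prednK.
Qed.

Lemma mpolyX_dvdX m i : (1 <= m i)%N ->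
  exists c, 'X_[m] = 'X_i * c :> {mpoly k[n]}.
Proof.
move=> m_gt0; exists ('X_i ^+ (m i).-1 * \prod_(j < n | j != i) 'X_j ^+ m j).
by rewrite mpolyXE_id (bigD1 i) //= mulrA -exprS prednK.
Qed.

Lemma lreg_mpolyX (S : comNzRingType) (j : {rmorphism {mpoly k[n]} -> S}) m :
  (forall i, GRing.lreg (j 'X_i)) -> GRing.lreg (j 'X_[m]).
Proof.
move=> X_reg; rewrite mpolyXE_id rmorph_prod.
apply: (big_ind (fun c => GRing.lreg c)) => [||i _]; [exact: lreg1|exact: lregM|].
by rewrite rmorphXn; apply: lregX.
Qed.

Lemma monomial_lreg d e (P : {poly {mpoly k[n]}}) (Q : {poly {poly {mpoly k[n]}}}) m :
  (forall i, 1 <= d i)%N -> (forall i, 1 <= e i)%N -> P \is monic -> Q \is monic ->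
  GRing.lreg (dd_base (monomial_neq0 k d) (monomial_neq0 k e) P Q 'X_[m]).
Proof.
move=> d1 e1 Pm Qm; apply: lreg_mpolyX => i.
have [[d' dE] [e' eE]] := (mpolyX_dvdX (d1 i), mpolyX_dvdX (e1 i)).
have X0 : 'X_i != 0 :> {mpoly k[n]}.
  by have := monomial_neq0 k U_(i)%MM; rewrite polyC_eq0.
exact: (dd_base_lreg X0 dE eE Pm Qm).
Qed.

End Monomials.

Theorem theorem3p1 (k : fieldType) (n : nat) (d : 'X_{1..n})
    (P : {poly {mpoly k[n]}}) (Q : {poly {poly {mpoly k[n]}}}) :
  (1 <= n)%N ->
  (forall i : 'I_n, 1 <= d i)%N ->
  P \is monic -> (2 <= (size P).-1)%N ->
  Q \is monic -> (2 <= (size Q).-1)%N ->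
  (forall i : 'I_n,
     is_unit_ideal [:: map_poly (setX0 i) P; map_poly (setX0 i) P^`()]) ->
  (forall i : 'I_n,
     is_unit_ideal [:: (map_poly (setX0 i) P)%:P;
                       map_poly (map_poly (setX0 i)) Q;
                       map_poly (map_poly (setX0 i)) Q^`()]) ->
  forall e : 'X_{1..n}, (forall i : 'I_n, 2 <= e i)%N ->
  algebras_isomorphic (dd_poly_const d e P Q)
    (dd_poly_const d [multinom (e i).-1 | i < n] P Q).
Proof.
move=> _ d1 Pm _ Qm _ P_unit Q_unit e e2.
set e' := [multinom (e i).-1 | i < n].
have e1 i : (1 <= e i)%N by apply: ltn_trans (e2 i).
have e'1 i : (1 <= e' i)%N by rewrite mnmE -ltnS prednK.
have slope_unit : unit_mod P%:P Q (\prod_(i < n) 'X_i)%:P%:P (P^`()%:P * Q^`()).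
  rewrite !rmorph_prod; apply: unit_modM; apply: unit_mod_prod => i.
    exact: unit_mod_derivP.
  exact: unit_mod_derivQ.
pose iB := dd_base (monomial_neq0 k d) (monomial_neq0 k e) P Q.
pose iB' := dd_base (monomial_neq0 k d) (monomial_neq0 k e') P Q.
have iB_reg m : GRing.lreg (iB 'X_[m]) by exact: monomial_lreg.
have iB'_reg m : GRing.lreg (iB' 'X_[m]) by exact: monomial_lreg.
have x_reg : GRing.lreg (iB' (\prod_(i < n) 'X_i)).
  have <- : 'X_[[multinom 1%N | i < n]] = \prod_(i < n) 'X_i :> {mpoly k[n]}.
    by rewrite mpolyXE_id; apply: eq_bigr => i _; rewrite mnmE.
  exact: iB'_reg.
exact: (dquot_stable_iso (mpolyX_pred k d1) (mpolyX_pred k e1)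
  (mpolyX_pred k e'1) slope_unit (iB_reg d) (iB_reg e) (iB'_reg d) (iB'_reg e') x_reg
  (@mpolyC n k)).
Qed.
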